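(* Let $P$ be the transition matrix of a finite irreducible Markov chain with states $\{1,\dots,m\}$, stationary probability vector $\boldsymbol{\pi}^T=(\pi_1,\dots,\pi_m)$, mean first passage times $\{m_{ij}\}$ and second moments of the recurrence times $\{m_{jj}^{(2)}\}$. Let $G=[g_{ij}]$ be a g-inverse of $I-P$ belonging to $A\{1,5\}$, so that $G=G(\boldsymbol{e},\boldsymbol{\pi},\gamma)$ for some $\gamma$. Then $$g_{ij}=\begin{cases}\pi_j\left(\gamma+\dfrac{\pi_jm_{jj}^{(2)}+1}{2}-m_{ij}\right), & i\neq j,\\[8pt] \pi_j\left(\gamma+\dfrac{\pi_jm_{jj}^{(2)}+1}{2}\right), & i=j.\end{cases}$$
   Context: $\boldsymbol{e}$ is the all-ones column vector; $\boldsymbol{\pi}^T$ is the unique stationary probability vector ($\boldsymbol{\pi}^TP=\boldsymbol{\pi}^T$, $\boldsymbol{\pi}^T\boldsymbol{e}=1$). $T_{ij}=\min\{n\ge 1: X_n=j\}$ given $X_0=i$ (first return when $i=j$), $m_{ij}=E[T_{ij}\mid X_0=i]$ and $m^{(2)}_{ij}=E[T_{ij}^2\mid X_0=i]$; these are finite and $m_{jj}=1/\pi_j$. A g-inverse of $I-P$ is a real $m\times m$ matrix $G$ with $(I-P)G(I-P)=I-P$. Parametric form (known fact): every g-inverse $G$ of $I-P$ can be uniquely written as $G=[I-P+\boldsymbol{\alpha}\boldsymbol{\beta}^T]^{-1}+\gamma\boldsymbol{e}\boldsymbol{\pi}^T$ with $\boldsymbol{\alpha},\boldsymbol{\beta}\in\mathbb{R}^m$,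 $\gamma\in\mathbb{R}$, $\boldsymbol{\pi}^T\boldsymbol{\alpha}=1$, $\boldsymbol{\beta}^T\boldsymbol{e}=1$; this is written $G=G(\boldsymbol{\alpha},\boldsymbol{\beta},\gamma)$. $A\{1,5\}$ is the class of g-inverses $G$ of $I-P$ that commute with $I-P$; it is known that $G\in A\{1,5\}$ iff $\boldsymbol{\alpha}=\boldsymbol{e}$ and $\boldsymbol{\beta}=\boldsymbol{\pi}$. *)

(* Defs.v *)
From HB Require Import structures.
From mathcomp Require Import all_boot all_order all_algebra.
From mathcomp Require Import all_classical all_reals all_analysis.

Set Implicit Arguments.
Unset Strict Implicit.
Unset Printing Implicit Defensive.

Import Order.TTheory GRing.Theory Num.Theory.
Local Open Scope classical_set_scope.
Local Open Scope ring_scope.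

Section MarkovMatrix.
Variables (R : realType) (m : nat).
Implicit Types (P G : 'M[R]_m) (pi : 'rV[R]_m).

(* The all-ones column vector. *)
Definition ones : 'cV[R]_m := const_mx 1.

Definition transition_matrix P : Prop :=
  (forall i j, 0 <= P i j) /\ P *m ones = ones.

Definition irreducible P : Prop := forall i j, exists n : nat, 0 < (P ^+ n) i j.

(* [pi *m ones] is a 1 x 1 matrix, hence the right-hand side [1%:M]. *)
Definition stationary_vector P pi : Prop :=
  [/\ forall j, 0 <= pi 0 j, pi *m ones = 1%:M & pi *m P = pi].

Definition g_inverse (A G : 'M[R]_m) : Prop := A *m G *m A = A.

(* The class A{1,5}: g-inverses of A commuting with A. *)
Definition g_inverse15 (A G : 'M[R]_m) : Prop := g_inverse A G /\ comm_mx A G.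

(* G(alpha, beta, gamma). It is meant for pi *m alpha = 1 and beta^T *m e = 1,
   in which case the matrix inverted is nonsingular when P is irreducible. *)
Definition param_g_inverse P pi (alpha beta : 'cV[R]_m) (gamma : R) : 'M[R]_m :=
  invmx (1%:M - P + alpha *m beta^T) + gamma *: (ones *m pi).

End MarkovMatrix.

Arguments ones {R m}.

Section MarkovChain.
Context {d : measure_display} {T : measurableType d} {R : realType} {m : nat}.
Implicit Types (X : nat -> T -> 'I_m) (Pr : 'I_m -> probability T R).

(* X is a homogeneous Markov chain with transition matrix P, where [Pr i] is the
   law given X_0 = i. The last clause is the Markov property
     Pr(X_{n+1} = x_{n+1} | X_0 = x_0, ..., X_n = x_n) = P x_n x_{n+1}
   multiplied by the probability of the conditioning event. *)
Definition markov_chain (P : 'M[R]_m) Pr X : Prop :=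
  [/\ forall n j, measurable [set w | X n w = j],
      forall i, Pr i [set w | X 0%N w = i] = 1%E &
      forall i (n : nat) (x : nat -> 'I_m),
        Pr i [set w | forall k, (k <= n.+1)%N -> X k w = x k] =
        (Pr i [set w | forall k, (k <= n)%N -> X k w = x k]
          * (P (x n) (x n.+1))%:E)%E].

(* min {n >= 1 : X_n = j}, equal to +oo if j is never reached. *)
Definition first_passage_time X (j : 'I_m) (w : T) : \bar R :=
  ereal_inf [set n%:R%:E | n in [set n : nat | (0 < n)%N /\ X n w = j]].

(* [fine] loses nothing: for a finite irreducible chain both integrals
   are finite. *)
Definition mean_passage_time Pr X (i j : 'I_m) : R :=
  fine (\int[Pr i]_w first_passage_time X j w)%E.

Definition second_moment_passage_time Pr X (i j : 'I_m) : R :=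
  fine (\int[Pr i]_w (first_passage_time X j w ^+ 2))%E.

End MarkovChain.

(* Main.v *)
(* Write Z for the inverse of I - P + e pi; a g-inverse commuting with I - P differs
   from Z by a multiple of e pi because harmonic vectors are constant.
   Fix j and let Q be P with its j-th column set to 0, so that (Q^n e)_i is the
   probability that T_ij > n. Hence E T_ij = sum_n (Q^n e)_i and
   E T_ij^2 = sum_n (2n+1) (Q^n e)_i, and these series converge to any solutions
   x = e + Q x and y = e + 2 Q x + Q y, which are automatically nonnegative by the
   minimum principle. Such solutions are written down explicitly in terms of Z:
   one finds x_i = (z_jj - z_ij + delta_ij) / pi_j and
   pi_j y_j = 2 z_jj / pi_j - 1, and solving for z_jj and z_ij gives the formula. *)

Require Import Defs.
From HB Require Import structures.
From mathcomp Require Import all_boot all_order all_algebra.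
From mathcomp Require Import all_classical all_reals all_analysis.
From mathcomp Require Import measurable_realfun ring lra.
Import Order.TTheory GRing.Theory Num.Theory.
Import numFieldNormedType.Exports.
Local Open Scope ring_scope.

(** * Preliminaries: the killed matrix and a criterion for summing series *)

Lemma addmx_entry {R : realType} {m n} (A B : 'M[R]_(m, n)) i j :
  (A + B) i j = A i j + B i j.
Proof. by rewrite mxE. Qed.

Lemma oppmx_entry {R : realType} {m n} (A : 'M[R]_(m, n)) i j :
  (- A) i j = - A i j.
Proof. by rewrite mxE. Qed.

Lemma scalemx_entry {R : realType} {m n} c (A : 'M[R]_(m, n)) i j :
  (c *: A) i j = c * A i j.
Proof. by rewrite mxE. Qed.

(* [killed P j ^+ n *m ones] is the vector of probabilities of avoiding [j] at
   times 1, ..., n. *)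
Definition killed {R : realType} {m : nat} (P : 'M[R]_m) j : 'M[R]_m :=
  P *m (1%:M - delta_mx j j).

Lemma killedE {R : realType} {m : nat} (P : 'M[R]_m) j i k :
  killed P j i k = if k == j then 0 else P i k.
Proof.
rewrite mxE (bigD1 k) //= big1 => [|l lk].
  by rewrite !mxE eqxx andbb addr0; case: eqP => _; rewrite ?subrr ?subr0 ?mulr0 ?mulr1.
by rewrite !mxE (negPf lk) sub0r; case: (k =P j) => [<-|]; rewrite ?(negPf lk) ?andbF oppr0 mulr0.
Qed.

Lemma killed_ge0 {R : realType} {m : nat} (P : 'M[R]_m) j i k :
  transition_matrix P -> 0 <= killed P j i k.
Proof. by case=> P0 _; rewrite killedE; case: ifP. Qed.

Lemma killed_row_le1 {R : realType} {m : nat} (P : 'M[R]_m) j i :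
  transition_matrix P -> \sum_k killed P j i k <= 1.
Proof.
case=> P0 /matrixP/(_ i 0); rewrite !mxE => <-; apply: ler_sum => k _.
by rewrite killedE mxE mulr1; case: ifP.
Qed.

Lemma exprmx_ge0 {R : realType} {m : nat} (A : 'M[R]_m) n i j :
  (forall i j, 0 <= A i j) -> 0 <= (A ^+ n) i j.
Proof.
move=> A0; elim: n i j => [|n IH] i j; first by rewrite expr0 !mxE ler0n.
by rewrite exprS mxE sumr_ge0 // => k _; rewrite mulr_ge0.
Qed.

(* The terms of a convergent series vanish in the limit, hence so do the remainders [r]. *)
Lemma nneseries_remainder {R : realType} (a t r : nat -> R) (v C : R) :
  (forall n, 0 <= a n * t n) ->
  (forall n, \sum_(0 <= k < n) a k * t k + r n = v) ->
  (forall n, 0 <= r n <= C * (a n * t n)) ->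
  (\sum_(0 <= n <oo) (a n * t n)%:E)%E = v%:E.
Proof.
move=> at0 sumE rb; pose u := [sequence a n * t n]_n.
have uv n : series u n = v - r n by rewrite -(sumE n) addrK.
have cu : cvgn (series u).
  apply: nondecreasing_is_cvgn.
    by apply: nondecreasing_series => n _ _; apply: at0.
  by exists v => _ [n _ <-]; rewrite uv gerBl; case/andP: (rb n).
have u0 := cvg_series_cvg_0 cu.
have r0 : (r @ \oo --> 0)%classic.
  apply: (@squeeze_cvgr _ _ _ _ (fun=> 0) (fun n => C * u n)).
  - by apply: nearW => n; apply: rb.
  - exact: cvg_cst.
  - by rewrite -(mulr0 C); apply: cvgMl_tmp.
have uv' : (series u @ \oo --> v)%classic.
  have -> : series u = (fun n => v - r n) by apply/funext.
  by rewrite -[X in (_ --> X)%classic]subr0; apply: cvgB => //; exact: cvg_cst.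
rewrite -(cvg_lim _ uv') // -EFin_lim //.
by congr (limn _); apply/funext => n /=; rewrite sumEFin.
Qed.

(** * Series in the powers of a substochastic matrix *)

Section Substochastic.
Context {R : realType} {m : nat}.
Variable Q : 'M[R]_m.
Hypotheses (Q_ge0 : forall i j, 0 <= Q i j).
Hypotheses (Q_sub : forall i, \sum_j Q i j <= 1).

(** Minimum principle: at an index [i0] of the least entry, a negative [v i0 0] times a row sum at
    most 1 is at least [v i0 0], so the equation would give [v i0 0 >= b i0 0 + v i0 0]. *)
Lemma substochastic_solution_ge0 (b v : 'cV[R]_m) i :
  (forall i, 0 < b i 0) -> v = b + Q *m v -> 0 <= v i 0.
Proof.
move=> b0 vE; have [i0 _ i0min] := @arg_minP _ _ _ i predT (fun l => v l 0) isT.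
apply: le_trans (i0min i isT); rewrite leNgt; apply/negP => vi0.
have := congr1 (fun v : 'cV_m => v i0 0) vE; rewrite !mxE => vi0E.
have : \sum_k Q i0 k * v i0 0 <= \sum_k Q i0 k * v k 0.
  by apply: ler_sum => k _; rewrite ler_wpM2l // i0min.
rewrite -mulr_suml; have := ler_wnM2r (ltW vi0) (Q_sub i0); have := b0 i0.
by rewrite mul1r; lra.
Qed.

Lemma mulmx_exprSr n : Q ^+ n *m Q = Q ^+ n.+1. Proof. by rewrite exprSr. Qed.

Lemma survival_ge0 n i : 0 <= (Q ^+ n *m ones) i 0.
Proof.
by rewrite mxE sumr_ge0 // => k _; rewrite mulr_ge0 ?mxE ?ler01 // exprmx_ge0.
Qed.

(** Every entry of [v] is at most [C], the sum of all of them. The bound compares remainders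
    [Q ^+ n *m v] with the terms of the series, as [nneseries_remainder] requires. *)
Lemma survival_bound (v : 'cV[R]_m) : (forall i, 0 <= v i 0) ->
  exists2 C, 0 <= C & forall n i,
    0 <= (Q ^+ n *m v) i 0 <= C * (Q ^+ n *m ones) i 0.
Proof.
move=> v0; exists (\sum_i v i 0) => [|n i]; first exact: sumr_ge0.
apply/andP; split; rewrite !mxE.
  by rewrite sumr_ge0 // => k _; rewrite mulr_ge0 // exprmx_ge0.
rewrite mulr_sumr; apply: ler_sum => k _; rewrite mxE mulr1 mulrC.
by rewrite ler_wpM2r ?exprmx_ge0 // (bigD1 k) //= lerDl sumr_ge0.
Qed.

(** Iterating the equation [n] times leaves the remainder [Q ^+ n *m x]. *)
Lemma survival_series (x : 'cV[R]_m) i : x = ones + Q *m x ->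
  (\sum_(0 <= n <oo) ((Q ^+ n *m ones) i 0)%:E)%E = (x i 0)%:E.
Proof.
move=> xE; have x0 k : 0 <= x k 0.
  by apply: (@substochastic_solution_ge0 ones) => // l; rewrite mxE.
have [C C0 QC] := survival_bound _ x0.
rewrite -(@nneseries_remainder R (fun=> 1) (fun n => (Q ^+ n *m ones) i 0) (fun n => (Q ^+ n *m x) i 0) (x i 0) C).
- by under [RHS]eq_eseriesr do rewrite mul1r.
- by move=> n; rewrite mul1r survival_ge0.
- elim=> [|n IH]; first by rewrite big_nil expr0 mul1mx add0r.
  rewrite big_nat_recr //= -addrA -{}[RHS]IH; congr (_ + _).
  by rewrite {2}xE mulmxDr [in RHS]mxE mulmxA mulmx_exprSr mul1r.
- by move=> n; rewrite mul1r QC.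
Qed.

Lemma survival_series2 (x y : 'cV[R]_m) i :
  x = ones + Q *m x -> y = ones + 2 *: (Q *m x) + Q *m y ->
  (\sum_(0 <= n <oo) ((n.*2.+1)%:R * (Q ^+ n *m ones) i 0)%:E)%E = (y i 0)%:E.
Proof.
move=> xE yE; have x0 k : 0 <= x k 0.
  by apply: (@substochastic_solution_ge0 ones) => // l; rewrite mxE.
have y0 k : 0 <= y k 0.
  apply: (@substochastic_solution_ge0 (ones + 2 *: (Q *m x))) => // l.
  (* The bound at [n = 1] shows that [Q *m x] is nonnegative, so the source term is at least 1. *)
  have := survival_bound _ x0 => -[C _ /(_ 1 l)]; rewrite expr1 !mxE => /andP[].
  lra.
have [C C0 QC] := survival_bound _ x0; have [D D0 QD] := survival_bound _ y0.
(* The remainder of order n is [Q^n (y + 2 n x)], bounded by [(C + D) (2n+1) Q^n e]. *)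
pose r n := (Q ^+ n *m (y + (2 * n%:R) *: x)) i 0.
rewrite -(@nneseries_remainder R (fun n => n.*2.+1%:R) (fun n => (Q ^+ n *m ones) i 0) r (y i 0) (C + D)) //.
- by move=> n; rewrite mulr_ge0 // survival_ge0.
- rewrite /r; elim=> [|n IH]; first by rewrite big_nil expr0 mul1mx add0r mulr0 scale0r addr0.
  rewrite big_nat_recr //= -addrA -{}[RHS]IH; congr (_ + _).
  have -> : y + (2 * n%:R) *: x = n.*2.+1%:R *: ones + Q *m (y + (2 * n.+1%:R) *: x).
    rewrite mulmxDr -scalemxAr {1}yE {2}xE; apply/matrixP => k l.
    by rewrite !mxE -mul2n -[in RHS]natr1 natrM -natr1; ring.
  by rewrite [in RHS]mulmxDr -[in RHS]scalemxAr mulmxA mulmx_exprSr addmx_entry scalemx_entry.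
- move=> n; rewrite /r mulmxDr -scalemxAr addmx_entry scalemx_entry.
  have /andP[Qx0 QxC] := QC n i; have /andP[Qy0 QyD] := QD n i.
  have n0 : 0 <= n%:R :> R by [].
  have t0 := survival_ge0 n i.
  apply/andP; split; first by rewrite addr_ge0 // mulr_ge0 // mulr_ge0.
  have -> : n.*2.+1%:R = 2 * n%:R + 1 :> R by rewrite -[LHS]natr1 -mul2n natrM.
  move: Qx0 QxC Qy0 QyD t0 n0.
  move: ((Q ^+ n *m x) i 0) ((Q ^+ n *m y) i 0) ((Q ^+ n *m ones) i 0) (n%:R : R) => X Y s N.
  (* [(C + D) * ((2 * N + 1) * s)] exceeds [D * s + 2 * N * (C * s)] by [C * s + 2 * (D * s * N)],
     whose two terms are shown nonnegative here. *)
  move=> *; have : N * X <= N * (C * s) by apply: ler_wpM2l.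
  have : 0 <= D * s * N by rewrite !mulr_ge0.
  have : 0 <= C * s by rewrite !mulr_ge0.
  nra.
Qed.

End Substochastic.

(** * The fundamental matrix and the commuting g-inverses *)

Section FundamentalMatrix.
Context {R : realType} {m : nat}.
Variables (P : 'M[R]_m) (pi : 'rV[R]_m).
Hypotheses (P_trans : transition_matrix P) (P_irr : irreducible P).
Hypothesis pi_stat : stationary_vector P pi.

Lemma exprmx_fixr {p} (A : 'M[R]_m) (B : 'M[R]_(m, p)) n :
  A *m B = B -> A ^+ n *m B = B.
Proof.
by move=> AB; elim: n => [|n IH]; rewrite ?expr0 ?mul1mx // exprSr -mulmxA AB.
Qed.

Lemma exprmx_fixl {p} (A : 'M[R]_m) (B : 'M[R]_(p, m)) n :
  B *m A = B -> B *m A ^+ n = B.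
Proof.
by move=> BA; elim: n => [|n IH]; rewrite ?expr0 ?mulmx1 // exprS mulmxA BA.
Qed.

(** Maximum principle: at a maximizer [i0], the average of the nonnegative gaps [v i0 0 - v l 0]
    under row [i0] of [P ^+ n] vanishes, so the gap is zero wherever that row is positive.
    Irreducibility reaches every state with a suitable [n]. *)
Lemma harmonic_const (v : 'cV[R]_m) i k : P *m v = v -> v i 0 = v k 0.
Proof.
case: P_trans => P0 P1 Pv.
suff H i0 : (forall l, v l 0 <= v i0 0) -> forall k0, v k0 0 = v i0 0.
  have [i0 _ i0max] := @arg_maxP _ _ _ i predT (fun l => v l 0) isT.
  by rewrite !(H i0) // => l; apply: i0max.
move=> i0max k0; have [n Pn0] := P_irr i0 k0.
have Pnv := exprmx_fixr _ _ n Pv; have Pn1 := exprmx_fixr _ _ n P1.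
have : \sum_l (P ^+ n) i0 l * (v i0 0 - v l 0) = 0.
  under eq_bigr do rewrite mulrBr.
  rewrite sumrB -mulr_suml; apply/eqP; rewrite subr_eq0; apply/eqP.
  have -> : \sum_l (P ^+ n) i0 l = 1.
    by move/matrixP/(_ i0 0): Pn1; rewrite !mxE => <-; apply: eq_bigr => l _; rewrite mxE mulr1.
  by move/matrixP/(_ i0 0): Pnv; rewrite !mxE mul1r => <-.
move/eqP; rewrite psumr_eq0; last first.
  by move=> l _; rewrite mulr_ge0 ?subr_ge0 // exprmx_ge0.
move/allP/(_ k0 (mem_index_enum k0)) => /=.
by rewrite mulf_eq0 gt_eqF //= subr_eq0 => /eqP.
Qed.

(** Columns are constant, hence equal to their [pi]-averages. A matrix killed by [I - P] is thus
    determined by [pi *m B]. *)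
Lemma harmonic_mx {p} (B : 'M[R]_(m, p)) : P *m B = B -> B = ones *m (pi *m B).
Proof.
case: pi_stat => _ pi1 _ PB; apply/matrixP => i c.
rewrite mulmxA [in RHS]mxE.
have H k : B k c = B i c.
  have Pc : P *m col c B = col c B by rewrite colE mulmxA PB.
  by have := harmonic_const _ k i Pc; rewrite !mxE.
under eq_bigr do rewrite H mxE big_ord1 mxE mul1r.
rewrite -mulr_suml; move/matrixP/(_ 0 0): pi1; rewrite !mxE => pi1.
have -> : \sum_k pi 0 k = 1.
  by rewrite -[RHS]pi1; apply: eq_bigr => l _; rewrite mxE mulr1.
by rewrite mul1r.
Qed.

(** Some [pi 0 i] is positive as the total mass is 1, and [pi = pi *m P ^+ n] carries part of that
    mass to [j]. *)
Lemma stationary_gt0 j : 0 < pi 0 j.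
Proof.
case: pi_stat => pi0 pi1 piP; case: P_trans => P0 _.
have [i pii] : exists i, 0 < pi 0 i.
  apply/not_existsP => H; move/matrixP/(_ 0 0): pi1; rewrite !mxE big1.
    by move/esym/eqP; rewrite oner_eq0.
  move=> k _; have /negP := H k; rewrite -leNgt => k0.
  by rewrite (le_anti (introT andP (conj k0 (pi0 k)))) mul0r.
have [n Pn] := P_irr i j.
have /matrixP/(_ 0 j) := exprmx_fixl _ _ n piP.
rewrite mxE => <-; rewrite (bigD1 i) //= ltr_wpDr ?mulr_gt0 //.
by apply: sumr_ge0 => k _; rewrite mulr_ge0 // exprmx_ge0.
Qed.

(** The fundamental matrix of Kemeny and Snell. *)
Definition fundamental_matrix := invmx (1%:M - P + ones *m pi).

Local Notation Z := fundamental_matrix.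

(** If the matrix annihilates [B], multiplying by [pi] on the left gives [pi *m B = 0]; then [B] is
    harmonic with zero average, so it vanishes. *)
Lemma fundamental_unit : 1%:M - P + ones *m pi \in unitmx.
Proof.
case: pi_stat => pi0 pi1 piP.
rewrite -row_full_unit -cokermx_eq0; apply/eqP.
set B := cokermx _.
have B0 : (1%:M - P + ones *m pi) *m B = 0 by apply: mulmx_coker.
have piB : pi *m B = 0.
  have := congr1 (mulmx pi) B0.
  by rewrite mulmxA mulmxDr mulmxBr mulmx1 piP subrr add0r mulmxA pi1 mul1mx mulmx0.
suff PB : P *m B = B by rewrite (harmonic_mx _ PB) piB mulmx0.
move: B0; rewrite mulmxDl -mulmxA piB mulmx0 addr0 mulmxBl mul1mx => /eqP.
by rewrite subr_eq0 => /eqP.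
Qed.

Lemma fundamental_stationary : pi *m Z = pi.
Proof.
case: pi_stat => pi0 pi1 piP.
rewrite -[in LHS](_ : pi *m (1%:M - P + ones *m pi) = pi) ?mulmxK ?fundamental_unit //.
by rewrite mulmxDr mulmxBr mulmx1 piP subrr add0r mulmxA pi1 mul1mx.
Qed.

Lemma fundamental_ones : Z *m ones = ones.
Proof.
case: pi_stat => pi0 pi1 piP; case: P_trans => _ P1.
rewrite -[in LHS](_ : (1%:M - P + ones *m pi) *m ones = ones) ?mulKmx ?fundamental_unit //.
by rewrite mulmxDl mulmxBl mul1mx P1 subrr add0r -mulmxA pi1 mulmx1.
Qed.

Lemma mul_fundamental : (1%:M - P) *m Z = 1%:M - ones *m pi.
Proof.
rewrite -[X in _ - ones *m X]fundamental_stationary mulmxA.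
apply: (canRL (addrK _)); rewrite -mulmxDl; exact: mulmxV fundamental_unit.
Qed.

(** Both [G *m ones] and [1%:M - G *m A] are harmonic, so their [pi]-averages determine them. This
    gives [G] times the inverse of [Z], and multiplying by [Z] recovers [G]. *)
Lemma g_inverse15_param (G : 'M[R]_m) :
  g_inverse15 (1%:M - P) G -> exists gamma, G = Z + gamma *: (ones *m pi).
Proof.
case: pi_stat => pi0 pi1 piP; case: P_trans => _ P1.
case=> AGA AG; set A := 1%:M - P in AGA AG.
have A1 : A *m ones = 0 by rewrite mulmxBl mul1mx P1 subrr.
have piA : pi *m A = 0 by rewrite mulmxBr mulmx1 piP subrr.
have fixP p (B : 'M[R]_(m, p)) : A *m B = 0 -> P *m B = B.
  by rewrite mulmxBl mul1mx => /eqP; rewrite subr_eq0 => /eqP.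
set g := (pi *m (G *m ones)) 0 0.
have G1 : G *m ones = g *: ones.
  rewrite [LHS]harmonic_mx; last by apply: fixP; rewrite mulmxA AG -mulmxA A1 mulmx0.
  by rewrite [pi *m _]mx11_scalar mul_mx_scalar.
have GA : G *m A = 1%:M - ones *m pi.
  have GAfix : P *m (1%:M - G *m A) = 1%:M - G *m A.
    by apply: fixP; rewrite mulmxBr mulmx1 mulmxA AGA subrr.
  have piGA : pi *m (G *m A) = 0 by rewrite -AG mulmxA piA mul0mx.
  have := harmonic_mx _ GAfix.
  by rewrite [pi *m _]mulmxBr mulmx1 piGA subr0 => <-; rewrite opprB addrC subrK.
(* [Z] and [ones *m pi] both fix [ones], whereas [G] scales it by [g]; hence [1 + gamma = g]. *)
exists (g - 1).
rewrite -[LHS](mulmxK fundamental_unit) mulmxDr mulmxA G1 GA -scalemxAl.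
rewrite -addrA -{1}[ones *m pi]scale1r -scaleNr addrC -scalerDl addrC.
by rewrite mulmxDl mul1mx -/Z -scalemxAl -mulmxA fundamental_stationary [-1 + g]addrC.
Qed.

(* [v = w + s e_j], where (I - P) w = b - s e_j and w_j = 0; the value of [s] makes
   the right-hand side orthogonal to [pi], hence the equation solvable. *)
Lemma killed_system (b : 'cV[R]_m) j s v :
  s = (pi *m b) 0 0 / pi 0 j ->
  v = Z *m b + s *: (delta_mx j 0 - Z *m delta_mx j 0)
      + (s * Z j j - (Z *m b) j 0) *: ones ->
  v = b + killed P j *m v /\ v j 0 = s.
Proof.
case: pi_stat => pi0 pi1 piP; case: P_trans => _ P1 sE vE.
pose ej : 'cV[R]_m := delta_mx j 0; rewrite -/ej in vE.
have vj : v j 0 = s.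
  have Zej : (Z *m ej) j 0 = Z j j by rewrite -colE mxE.
  have e1 : ones j 0 = 1 :> R by rewrite mxE.
  have ejj : ej j 0 = 1 by rewrite mxE !eqxx.
  by rewrite vE !(addmx_entry, scalemx_entry, oppmx_entry) Zej e1 ejj; ring.
split=> //.
(* Column [j] of [killed P j] is zero, so the entry of [v] at [j] may be cleared. *)
have -> : killed P j *m v = P *m (v - s *: ej).
  rewrite -mulmxA mulmxBl mul1mx; congr (_ *m (_ - _)).
  apply/matrixP => i k; rewrite !ord1 !mxE (bigD1 j) //= big1 ?addr0 => [|l lj].
    by rewrite !mxE !eqxx !andbT vj mulrC.
  by rewrite !mxE (negPf lj) andbF mul0r.
have Aw : (1%:M - P) *m (v - s *: ej) = b - s *: ej.
  have -> : v - s *: ej = Z *m (b - s *: ej) + (s * Z j j - (Z *m b) j 0) *: ones.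
    rewrite vE mulmxBr -scalemxAr scalerBr.
    by rewrite addrAC; congr (_ + _); rewrite -addrA; congr (_ + _); rewrite addrAC subrr add0r.
  rewrite mulmxDr mulmxA mul_fundamental -scalemxAr.
  rewrite [_ *m ones]mulmxBl mul1mx P1 subrr scaler0 addr0.
  rewrite mulmxBl mul1mx -mulmxA.
  suff -> : pi *m (b - s *: ej) = 0 by rewrite mulmx0 subr0.
  rewrite mulmxBr -scalemxAr -colE; apply/matrixP => i k; rewrite !ord1 sE.
  by rewrite !mxE divfK ?subrr // gt_eqF // stationary_gt0.
move: Aw; rewrite mulmxBl mul1mx => /(canRL (subrK _)) Aw.
by rewrite -[LHS](subrK (s *: ej)) {1}Aw addrAC subrK.
Qed.

End FundamentalMatrix.

(** * Moments of passage times as series of avoidance probabilities *)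

Section Passage.
Local Open Scope classical_set_scope.
Context {R : realType} {m : nat} (P : 'M[R]_m).
Context {d : measure_display} {T : measurableType d}.
Context (Pr : 'I_m -> probability T R) (X : nat -> T -> 'I_m).
Hypothesis P_trans : transition_matrix P.
Hypothesis X_chain : markov_chain P Pr X.

Definition path_event (n : nat) (x : nat -> 'I_m) : set T :=
  [set w | forall k, (k <= n)%N -> X k w = x k].

(** The window starts after time [s], so that the chain may be in [j] at time [s], as for recurrence
    times. *)
Definition avoid_event (s r : nat) (j : 'I_m) : set T :=
  [set w | forall k, (s < k <= s + r)%N -> X k w != j].

Lemma measurable_path n x : measurable (path_event n x).
Proof.
case: X_chain => mX _ _.
rewrite (_ : path_event n x = \bigcap_(k in [set k | (k <= n)%N]) [set w | X k w = x k]) //.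
by apply: bigcap_measurableType => k _; apply: mX.
Qed.

Lemma measurable_avoid s r j : measurable (avoid_event s r j).
Proof.
case: X_chain => mX _ _.
rewrite (_ : avoid_event s r j = \bigcap_(k in [set k | (s < k <= s + r)%N]) ~` [set w | X k w = j]).
  by apply: bigcap_measurableType => k _; apply/measurableC/mX.
by apply/seteqP; split=> w H k /H => [/eqP//|/= H']; apply/eqP.
Qed.

Lemma measure_partition (mu : {measure set T -> \bar R}) (A : set T) (f : T -> 'I_m) :
  (forall l, measurable [set w | f w = l]) -> measurable A ->
  mu A = (\sum_l mu (A `&` [set w | f w = l]))%E.
Proof.
move=> mf mA; rewrite (fsbig_seq _ _ (index_enum_uniq 'I_m)).
rewrite -measure_fin_bigcup //=.
- congr (mu _); apply/seteqP; split=> [w Aw|w [l _ []]//].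
  by exists (f w); rewrite /= ?mem_index_enum.
- by move=> a b _ _ [w [[_ /= <-] [_ /= <-]]].
- by move=> l _; apply: measurableI.
Qed.

(** Induction on [r], splitting according to the state at time [s.+1]. The whole past is carried
    along because [markov_chain] states the Markov property for complete trajectories. *)
Lemma path_avoid i j r s x :
  Pr i (path_event s x `&` avoid_event s r j) =
  (Pr i (path_event s x) * ((killed P j ^+ r *m ones) (x s) 0)%:E)%E.
Proof.
case: (X_chain) => mX _ markov; elim: r s x => [|r IH] s x.
  rewrite expr0 mul1mx mxE mule1; congr (Pr i _); apply/seteqP; split=> [w []//|w xw].
  by split=> // k; rewrite addn0 => /andP[/leq_trans h /h]; rewrite ltnn.
rewrite (measure_partition _ _ (X s.+1)) //; last first.
  by apply: measurableI; [exact: measurable_path|exact: measurable_avoid].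
rewrite exprS -mulmxA [in RHS]mxE -sumEFin ge0_sume_distrr; last first.
  move=> k _; rewrite lee_fin mulr_ge0 ?killed_ge0 // survival_ge0 // => *; exact: killed_ge0.
apply: eq_bigr => l _; rewrite killedE.
have [->|lj] := eqVneq l j.
  rewrite mul0r mule0 (_ : _ `&` _ = set0) ?measure0 //.
  apply/seteqP; split=> // w [[_ /(_ s.+1)]].
  by rewrite ltnSn addnS ltnS leq_addr => /(_ isT)/eqP.
(* The trajectory extended by [l]; [path_event s.+1] reads nothing beyond time [s.+1]. *)
pose x' k := if k == s.+1 then l else x k.
have x's k : (k <= s)%N -> x' k = x k.
  by rewrite /x'; case: eqP => // ->; rewrite ltnn.
have x'l : x' s.+1 = l by rewrite /x' eqxx.
have pathE : path_event s x' = path_event s x.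
  by apply/seteqP; split=> w xw k ks; rewrite xw ?x's.
have markov' : Pr i (path_event s.+1 x') = (Pr i (path_event s x) * (P (x s) l)%:E)%E.
  by rewrite [LHS]markov -/(path_event s x') pathE x's // x'l.
have := IH s.+1 x'; rewrite x'l EFinM muleA -markov' => <-.
congr (Pr i _); apply/seteqP; split=> w.
  move=> [[xw aw] /= Xw]; split=> k.
    by rewrite leq_eqVlt ltnS => /predU1P[->|ks]; rewrite ?x'l// x's // xw.
  by rewrite addSnnS => /andP[sk ksr]; apply: aw; rewrite ksr ltnW.
move=> [xw aw]; have Xw : X s.+1 w = l by rewrite xw.
split=> //; split=> [k ks|k]; first by rewrite xw ?x's // ltnW.
rewrite -addSnnS => /andP[]; rewrite leq_eqVlt => /predU1P[<-|sk ksr].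
  by rewrite Xw.
by apply: aw; rewrite sk.
Qed.

(** The trajectory of length zero at [i] has probability 1, so intersecting with it changes
    nothing. *)
Lemma measure_avoid i j r :
  Pr i (avoid_event 0 r j) = ((killed P j ^+ r *m ones) i 0)%:E.
Proof.
case: (X_chain) => mX X0 _.
pose E := path_event 0 (fun=> i).
have PE : Pr i E = 1%E.
  rewrite -(X0 i); congr (Pr i _); apply/seteqP; split=> w /=; first exact.
  by move=> Xw k; rewrite leqn0 => /eqP ->.
have mE : measurable E by exact: measurable_path.
have mA : measurable (avoid_event 0 r j) by exact: measurable_avoid.
suff -> : Pr i (avoid_event 0 r j) = Pr i (E `&` avoid_event 0 r j).
  by rewrite path_avoid -/E PE mul1e.
rewrite [LHS](measureDI (Pr i) mA mE) (@subset_measure0 _ _ _ (Pr i) _ (~` E)).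
- by rewrite add0e setIC.
- exact: measurableD.
- exact: measurableC.
- by move=> w [].
- by rewrite [LHS](probability_setC (Pr i) mE) PE subee.
Qed.

(** Either the set of visiting times is empty, with infimum [+oo], or its least element [N] is the
    infimum. *)
Lemma first_passage_timeP j w :
  (first_passage_time X j w = +oo%E :> \bar R /\ forall n, avoid_event 0 n j w) \/
  exists N : nat, first_passage_time X j w = N%:R%:E :> \bar R /\
    forall n, avoid_event 0 n j w <-> (n < N)%N.
Proof.
have [[n0 [n0gt0 Xn0]]|noj] := pselect (exists n, (0 < n)%N /\ X n w = j); last first.
  left; split=> [|n k /andP[k0 _]]; last by apply/eqP => Xk; apply: noj; exists k.
  rewrite /first_passage_time (_ : [set n | _] = set0) ?image_set0 ?ereal_inf0 //.
  by apply/seteqP; split=> // n [n0 Xn]; apply: noj; exists n.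
have exn : exists n, (0 < n)%N && (X n w == j) by exists n0; rewrite n0gt0 Xn0 eqxx.
right; case: (ex_minnP exn) => N /andP[Ngt0 /eqP XN] Nmin; exists N; split.
  apply/eqP; rewrite eq_le; apply/andP; split.
    by apply: ereal_inf_lbound; exists N.
  apply: le_ereal_inf_tmp => _ [n [ngt0 Xn] <-].
  by rewrite lee_fin ler_nat Nmin // ngt0 Xn eqxx.
move=> n; split=> [avoid|nN k /andP[k0 kn]].
  by rewrite ltnNge; apply/negP => Nn; have := avoid N; rewrite Ngt0 => /(_ Nn); rewrite XN eqxx.
apply/negP => Xk; have := Nmin k; rewrite k0 Xk => /(_ isT) Nk.
by have := leq_ltn_trans (leq_trans Nk kn) nN; rewrite ltnn.
Qed.

Lemma nneseries_ge1_pinfty (a : nat -> R) : (forall n, 1 <= a n) ->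
  (\sum_(0 <= n <oo) (a n)%:E = +oo)%E.
Proof.
move=> a1; apply/eqyP => A A0.
pose k := Num.truncn A; have a0 n : (0 <= (a n)%:E)%E by rewrite lee_fin (le_trans _ (a1 n)).
apply: le_trans (nneseries_lim_ge k.+1 (fun n _ _ => a0 n)).
rewrite sumEFin lee_fin (le_trans (ltW (truncnS_gt A))) //.
rewrite -[k.+1%:R](_ : \sum_(0 <= i < k.+1) (1 : R) = k.+1%:R).
  by apply: ler_sum.
by rewrite big_const_nat subn0 iter_addr_0.
Qed.

(** Layer-cake formula: [a] is the sequence of increments of [f], and the events keep those with
    index below the passage time. The bound [1 <= a n] makes the series diverge where [j] is never
    reached. *)
Lemma first_passage_series (a : nat -> R) (f : \bar R -> \bar R) j w :
  (forall n, 1 <= a n) -> f +oo%E = +oo%E ->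
  (forall N : nat, f N%:R%:E = (\sum_(0 <= n < N) a n)%:E) ->
  f (first_passage_time X j w) =
  (\sum_(0 <= n <oo) (a n * \1_(avoid_event 0 n j) w)%:E)%E.
Proof.
move=> a1 fy fN; case: (first_passage_timeP j w) => [[-> avoid]|[N [-> avoid]]].
  rewrite fy -(nneseries_ge1_pinfty _ a1); apply: eq_eseriesr => n _.
  by rewrite indicE mem_set ?mulr1.
have a0 n : (0 <= (a n * \1_(avoid_event 0 n j) w)%:E)%E.
  by rewrite lee_fin mulr_ge0 // (le_trans _ (a1 n)).
rewrite (nneseries_split 0 N) // add0n [X in (_ + X)%E]eseries0 => [|n Nn _].
  rewrite adde0 fN -sumEFin !big_nat; apply: eq_bigr => n /= nN.
  by rewrite indicE mem_set ?mulr1 //; apply/avoid.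
by rewrite indicE memNset ?mulr0 // => /avoid; rewrite ltnNge Nn.
Qed.

(** Termwise integration of a nonnegative series; the identity holds in the extended reals, before
    finiteness is known. *)
Lemma integral_first_passage (a : nat -> R) (f : \bar R -> \bar R) i j :
  (forall n, 1 <= a n) -> f +oo%E = +oo%E ->
  (forall N : nat, f N%:R%:E = (\sum_(0 <= n < N) a n)%:E) ->
  (\int[Pr i]_w f (first_passage_time X j w) =
   \sum_(0 <= n <oo) (a n * (killed P j ^+ n *m ones) i 0)%:E)%E.
Proof.
move=> a1 fy fN.
under eq_integral do rewrite (first_passage_series a f) //.
have a0 n : 0 <= a n by rewrite (le_trans _ (a1 n)).
have mI n : measurable_fun [set: T] (EFin \o (\1_(avoid_event 0 n j) : T -> R)).
  by apply/measurable_EFinP/measurable_indic/measurable_avoid.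
rewrite integral_nneseries //; first last.
- by move=> n w _; rewrite lee_fin mulr_ge0.
- move=> n; under eq_fun do rewrite EFinM.
  exact: (measurable_funeM (a n)%:E (mI n)).
apply: eq_eseriesr => n _; under eq_integral do rewrite EFinM.
rewrite ge0_integralZl_EFin //; last exact: mI.
rewrite integral_indic //; last exact: measurable_avoid.
by rewrite setIT [X in (_ * X)%E]measure_avoid.
Qed.

(** The equation is first-step analysis. The integral is shown equal to a real number, so [fine] is
    applied to a finite value. *)
Lemma mean_passage_time_unique (x : 'cV[R]_m) i j :
  x = ones + killed P j *m x -> mean_passage_time Pr X i j = x i 0.
Proof.
move=> xE; rewrite /mean_passage_time (integral_first_passage (fun=> 1) id) //.
- under eq_eseriesr do rewrite mul1r.
  by rewrite (survival_series _ _ _ _ _ xE) // => *; [exact: killed_ge0|exact: killed_row_le1].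
- by move=> N; rewrite big_const_nat subn0 iter_addr_0.
Qed.

(** The equation for [y] is first-step analysis of the square of 1 plus the remaining time; the
    weights [2n+1] are the increments of [n^2]. *)
Lemma second_moment_passage_time_unique (x y : 'cV[R]_m) i j :
  x = ones + killed P j *m x ->
  y = ones + 2 *: (killed P j *m x) + killed P j *m y ->
  second_moment_passage_time Pr X i j = y i 0.
Proof.
move=> xE yE; rewrite /second_moment_passage_time.
rewrite (integral_first_passage (fun n => n.*2.+1%:R) (fun t => t ^+ 2)%E).
- by rewrite (survival_series2 _ _ _ _ _ _ xE yE) // => *; [exact: killed_ge0|exact: killed_row_le1].
- by move=> n; rewrite ler1n.
- by rewrite expe2 mulyy.
- move=> N; rewrite -EFin_expe; congr EFin; elim: N => [|N IH].
    by rewrite big_nil expr0n.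
  by rewrite big_nat_recr //= -IH -mul2n -!natr1 natrM; ring.
Qed.

End Passage.

(** * Explicit solutions and the entries of the g-inverse *)

Theorem theorem15 (R : realType) (m : nat) (P : 'M[R]_m) (pi : 'rV[R]_m)
    (d : measure_display) (T : measurableType d)
    (Pr : 'I_m -> probability T R) (X : nat -> T -> 'I_m) (G : 'M[R]_m)
    (P_trans : transition_matrix P) (P_irr : irreducible P)
    (pi_stat : stationary_vector P pi) (X_chain : markov_chain P Pr X)
    (G15 : g_inverse15 (1%:M - P) G) :
  (exists gamma : R, G = param_g_inverse P pi ones pi^T gamma) /\
  (forall gamma : R, G = param_g_inverse P pi ones pi^T gamma ->
    forall i j : 'I_m,
      G i j =
        if i != j then
          pi 0 j * (gamma
            + (pi 0 j * second_moment_passage_time Pr X j j + 1) / 2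
            - mean_passage_time Pr X i j)
        else
          pi 0 j * (gamma
            + (pi 0 j * second_moment_passage_time Pr X j j + 1) / 2)).
Proof.
split; first by have [gamma ->] := g_inverse15_param P pi P_trans P_irr pi_stat G G15;
  exists gamma; rewrite /param_g_inverse trmxK.
move=> gamma ->; rewrite /param_g_inverse trmxK -/(fundamental_matrix P pi) => i j.
set Z : 'M[R]_m := fundamental_matrix P pi.
have [pi0 pi1 piP] := pi_stat.
have pij := stationary_gt0 P pi P_trans P_irr pi_stat j.
have piZ : pi *m Z = pi := fundamental_stationary P pi P_trans P_irr pi_stat.
have Z1 : Z *m ones = ones := fundamental_ones P pi P_trans P_irr pi_stat.
have one00 : (1%:M : 'M[R]_1) 0 0 = 1 by rewrite mxE.
have onesE k : ones k 0 = 1 :> R by rewrite mxE.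
have ejE k : (delta_mx j 0 : 'cV[R]_m) k 0 = (k == j)%:R by rewrite mxE eqxx andbT.
have ZejE k : (Z *m (delta_mx j 0 : 'cV[R]_m)) k 0 = Z k j by rewrite -colE mxE.
have GE : (Z + gamma *: (ones *m pi)) i j = Z i j + gamma * pi 0 j.
  by rewrite !mxE big_ord1 mxE mul1r.
(* The solution given by [killed_system], for an arbitrary source [b]. *)
pose sol (b : 'cV[R]_m) := let s := (pi *m b) 0 0 / pi 0 j in
  Z *m b + s *: (delta_mx j 0 - Z *m delta_mx j 0)
  + (s * Z j j - (Z *m b) j 0) *: ones.
have solP b : sol b = b + killed P j *m sol b /\ sol b j 0 = (pi *m b) 0 0 / pi 0 j.
  exact: (killed_system P pi P_trans P_irr pi_stat b j _ _ erefl erefl).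
have [xE _] := solP ones; set x := sol ones in xE.
have xiE k : x k 0 = (Z j j - Z k j + (k == j)%:R) / pi 0 j.
  rewrite /x /sol !(addmx_entry, oppmx_entry, scalemx_entry) Z1 pi1 one00 !onesE ejE ZejE; ring.
(* As [pi *m Z = pi], the term with factor [s] in [sol] has zero [pi]-average. *)
have pix : (pi *m x) 0 0 = Z j j / pi 0 j.
  rewrite /x /sol Z1 pi1 one00 onesE !mulmxDr -!scalemxAr mulmxBr mulmxA piZ subrr.
  rewrite scaler0 addr0 pi1 addmx_entry scalemx_entry one00; ring.
have [yE yj] := solP (ones + 2 *: (killed P j *m x)); set y := sol _ in yE yj.
have yjE : y j 0 = (2 * (Z j j / pi 0 j) - 1) / pi 0 j.
  (* This turns the source into [2 *: x - ones], whose [pi]-average follows from [pix]. *)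
  rewrite yj (_ : killed P j *m x = x - ones); last by rewrite [in RHS]xE addrC addKr.
  rewrite mulmxDr -scalemxAr mulmxBr pi1 !(addmx_entry, oppmx_entry, scalemx_entry).
  rewrite pix one00; ring.
rewrite (mean_passage_time_unique P Pr X P_trans X_chain x i j xE).
rewrite (second_moment_passage_time_unique P Pr X P_trans X_chain x y j j xE yE).
have pin0 : pi 0 j != 0 by rewrite gt_eqF.
(* Here [(pi_j y_j + 1) / 2] is [z_jj / pi_j], and off the diagonal [pi_j x_i] is [z_jj - z_ij]. *)
rewrite GE xiE yjE; by case: eqVneq => [->|ij] /=; field.
Qed.
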